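(* There is an absolute constant $C>0$ such that the following holds. Let $n,d\ge1$ be integers, let $0<R_-\le R_+$ with $R_+\le2R_-$, and put $$\mathcal A=\{z\in\mathbb{R}^n:R_-\le\|z\|\le R_+\},\qquad\Delta=R_+-R_-.$$ Let $x\in\mathcal A$, let $\nu$ be a probability measure on $\mathcal A$, and put $q_i=\int|x_i-y_i|\,d\nu(y)$, $q=(q_1,\ldots,q_n)$. Then $$\left\|x^{\otimes d}-\int y^{\otimes d}\,d\nu(y)\right\|\le C\sqrt d\,R_+^{d-1}\|q\|_2+C\,d\,R_+^{d-2}\left(R_+\Delta+\int\|x-y\|^2\,d\nu(y)\right).$$
   Context: $x^{\otimes d}=x\otimes\cdots\otimes x$ ($d$ factors) is an element of the Hilbert tensor product $(\mathbb{R}^n)^{\otimes d}$, whose Hilbert norm is used on the left side; on $\mathbb{R}^n$ the norms are Euclidean. *)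

(* Defs.v *)
From HB Require Import structures.
From mathcomp Require Import all_boot all_order all_algebra.
From mathcomp Require Import all_classical all_reals all_analysis.

Set Implicit Arguments.
Unset Strict Implicit.
Unset Printing Implicit Defensive.

Import Order.TTheory GRing.Theory Num.Theory.
Import numFieldNormedType.Exports.

Local Open Scope classical_set_scope.
Local Open Scope ring_scope.

(* The library norm `|x| on 'rV[R]_n is the sup norm, hence this definition. *)
Definition enorm (R : realType) (n : nat) (x : 'rV[R]_n) : R :=
  Num.sqrt (\sum_(i < n) x 0 i ^+ 2).

(* 'rV[R]_n with its Borel sigma-algebra (generated by the open sets). *)
Definition borel_rV (R : realType) (n : nat) :=
  g_sigma_algebraType (@open 'rV[R]_n).

Definition annulus (R : realType) (n : nat) (Rm Rp : R) : set 'rV[R]_n :=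
  [set z | Rm <= enorm z <= Rp].

(* An element of (R^n)^{(x) d} is given by its coordinates in the basis
   e_(i 0) (x) ... (x) e_(i (d-1)), indexed by the maps i : 'I_d -> 'I_n; this
   basis is orthonormal for the Hilbert tensor product (see tdot_puret). *)
Definition tensor (R : realType) (n d : nat) :=
  {ffun {ffun 'I_d -> 'I_n} -> R}.

Definition tdot (R : realType) (n d : nat) (s t : tensor R n d) : R :=
  \sum_i s i * t i.

Definition tnorm (R : realType) (n d : nat) (t : tensor R n d) : R :=
  Num.sqrt (tdot t t).

(* The pure tensor v_0 (x) ... (x) v_(d-1). *)
Definition puret (R : realType) (n d : nat) (v : 'I_d -> 'rV[R]_n) :
    tensor R n d :=
  [ffun i : {ffun 'I_d -> 'I_n} => \prod_(k < d) v k 0 (i k)].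

Definition tpow (R : realType) (n d : nat) (x : 'rV[R]_n) : tensor R n d :=
  puret (fun=> x).

(* The tensor space is finite-dimensional: integration is coordinatewise. *)
Definition tintegral (R : realType) (n d : nat)
    (nu : probability (borel_rV R n) R) (F : 'rV[R]_n -> tensor R n d) :
    tensor R n d :=
  [ffun i => \int[nu]_y F y i].

Definition qvec (R : realType) (n : nat)
    (nu : probability (borel_rV R n) R) (x : 'rV[R]_n) : 'rV[R]_n :=
  \row_(i < n) \int[nu]_y `|x 0 i - (y : 'rV[R]_n) 0 i|.

Lemma tdot_puret (R : realType) (n d : nat) (v w : 'I_d -> 'rV[R]_n) :
  tdot (puret v) (puret w) = \prod_(k < d) \sum_(j < n) v k 0 j * w k 0 j.
Proof.
rewrite bigA_distr_bigA /=; apply: eq_bigr => i _.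
by rewrite !ffunE -big_split.
Qed.

(* Main.v *)
Require Import Defs.
From mathcomp Require Import all_boot all_order all_algebra.
From mathcomp Require Import all_classical all_reals all_analysis.
From mathcomp Require Import measurable_realfun.
From mathcomp Require Import ring lra.

Set Implicit Arguments.
Unset Strict Implicit.
Unset Printing Implicit Defensive.

Import Order.TTheory GRing.Theory Num.Theory.
Import numFieldNormedType.Exports.

Local Open Scope classical_set_scope.
Local Open Scope ring_scope.

(** The square of the left side is a double integral over [nu] of the kernel
    [<x^d - y^d, x^d - z^d>], which only involves inner products in [R^n]:
    with [N = |x|^2], [s = <x,y>], [t = <x,z>], [w = <y,z>] and [d]-th powers,
    it equals [N^d - s^d - t^d + w^d].  Inserting the value [(s t / N)^d] that
    [w^d] would take if the components of [y] and [z] orthogonal to [x] were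
    orthogonal to each other splits the kernel into
      [(s^d - N^d) (t^d - N^d) / N^d  +  (w^d - (s t / N)^d)].
    On the annulus every base occurring here is bounded by Cauchy-Schwarz, so
    the power function is Lipschitz with constant [d] times a power of the
    radius.  The first term is a product of a function of [y] and a function of
    [z], both controlled by the radial defect [|s - N|].  In the second one
      [w - s t / N = <x - y, x - z> - (s - N) (t - N) / N],
    and [|<x - y, x - z>| <= sum_i |x_i - y_i| |x_i - z_i|].  Putting the
    absolute values on the coordinates is what makes the double integral
    factor into [sum_i q_i^2], with the factor [d] rather than [d^2].  The
    part of this that concerns real numbers only is [power_kernel_le].

    Hence the kernel is dominated by a combination of products [f(y) f(z)], and
    [sqnorm_Rintegral_le] turns such a domination into a bound on the squared
    norm of the integral:
      [|int (x^d - y^d)|^2 <= d R^(2d-2) |q|^2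
                              + (d + d^2) R^(2d-2) / N (int |s - N|)^2].
    Finally [2 (s - N) = (|y|^2 - |x|^2) - |x - y|^2] and both norms lie within
    [Delta] of each other, so [|s - N| <= R Delta + |x - y|^2]
    ([normr_edotB_le]); taking square roots gives the estimate with constant
    [3]. *)

(** * Integrals dominated through a kernel *)

Lemma integrable_lincomb d (T : measurableType d) (R : realType)
    (mu : {measure set T -> \bar R}) (D : set T) (I : finType)
    (c : I -> R) (f : I -> T -> R) :
  measurable D -> (forall i, mu.-integrable D (EFin \o f i)) ->
  mu.-integrable D (EFin \o (fun y => \sum_i c i * f i y)).
Proof.
move=> mD fi.
have -> : EFin \o (fun y => \sum_i c i * f i y)
  = (fun y => \sum_i (c i)%:E * (EFin \o f i) y)%E.
  by apply/funext => y /=; rewrite -sumEFin.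
by apply: integrable_sum => // i _; exact: integrableZl.
Qed.

Lemma Rintegral_lincomb d (T : measurableType d) (R : realType)
    (mu : {measure set T -> \bar R}) (D : set T) (I : finType)
    (c : I -> R) (f : I -> T -> R) :
  measurable D -> (forall i, mu.-integrable D (EFin \o f i)) ->
  \int[mu]_(y in D) (\sum_i c i * f i y)
    = \sum_i c i * \int[mu]_(y in D) f i y.
Proof.
move=> mD fi.
have cfi i : mu.-integrable D (EFin \o (fun y => c i * f i y)).
  exact: (integrableZl mD (c i) (fi i)).
rewrite /Rintegral; under eq_integral do rewrite -sumEFin.
rewrite integral_sum//= -sum_fine; last first.
  by move=> i _; exact: (integrable_fin_num mD (cfi i)).
by apply: eq_bigr => i _; exact: (RintegralZl _ mD (fi i)).
Qed.

(** The left side is the integral in [y] and [z] of the kernel on the left of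
    the hypothesis, and the right side that of the dominating kernel.  Both
    kernels are finite sums of products of a function of [y] and a function of
    [z], so the two integrations are successive uses of linearity and
    monotonicity, and the order of integration is never exchanged. *)
Lemma sqnorm_Rintegral_le d (T : measurableType d) (R : realType)
    (mu : {measure set T -> \bar R}) (D : set T) (I J : finType)
    (a : I -> T -> R) (c : J -> R) (f : J -> T -> R) :
  measurable D ->
  (forall i, mu.-integrable D (EFin \o a i)) ->
  (forall j, mu.-integrable D (EFin \o f j)) ->
  (forall y z, D y -> D z ->
    \sum_i a i y * a i z <= \sum_j c j * (f j y * f j z)) ->
  \sum_i (\int[mu]_(y in D) a i y) ^+ 2
    <= \sum_j c j * (\int[mu]_(y in D) f j y) ^+ 2.
Proof.
move=> mD ai fi K.
set A := fun i => \int[mu]_(y in D) a i y.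
set F := fun j => \int[mu]_(y in D) f j y.
have K1 y : D y -> \sum_i A i * a i y <= \sum_j (c j * F j) * f j y.
  move=> Dy.
  have -> : \sum_i A i * a i y = \int[mu]_(z in D) \sum_i a i y * a i z.
    by rewrite Rintegral_lincomb//; apply: eq_bigr => i _; rewrite mulrC.
  have -> : \sum_j (c j * F j) * f j y
      = \int[mu]_(z in D) \sum_j (c j * f j y) * f j z.
    by rewrite Rintegral_lincomb//; apply: eq_bigr => j _; rewrite mulrAC.
  apply: le_Rintegral => //; [exact: integrable_lincomb..|move=> z Dz].
  by under [leRHS]eq_bigr do rewrite -mulrA; exact: K.
have -> : \sum_i A i ^+ 2 = \int[mu]_(y in D) \sum_i A i * a i y.
  by rewrite Rintegral_lincomb.
have -> : \sum_j c j * F j ^+ 2 = \int[mu]_(y in D) \sum_j (c j * F j) * f j y.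
  by rewrite Rintegral_lincomb//; apply: eq_bigr => j _; rewrite expr2 mulrA.
by apply: le_Rintegral => //; exact: integrable_lincomb.
Qed.

(** Passing to a set of full measure makes the integrands below bounded, since
    they are continuous on the compact annulus. *)
Lemma Rintegral_full_measure d (T : measurableType d) (R : realType)
    (P : probability T R) (D : set T) (f : T -> R) :
  measurable D -> P D = 1%E -> measurable_fun setT f ->
  \int[P]_y f y = \int[P]_(y in D) f y.
Proof.
move=> mD PD mf; rewrite [RHS]Rintegral_mkcond.
congr fine; apply: ae_eq_integral => //.
- exact/measurable_EFinP.
- apply/measurable_EFinP/(measurable_restrictT f) => //.
  exact: measurable_funTS.
- exists (~` D); split; first exact: measurableC.
    have := probability_setC P mD; rewrite PD subee//.
  move=> y /=; apply: contra_not => Dy _.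
  by rewrite patchE mem_set.
Qed.

(** * Continuous functions on the annulus *)

Lemma continuous_borel_measurable (R : realType) (n : nat)
    (f : 'rV[R]_n -> R) :
  continuous f -> measurable_fun setT (f : borel_rV R n -> R).
Proof.
move=> cf.
apply: (@measurability _ _ (borel_rV R n) R setT f _ (RGenOpens.measurableE R)).
move=> _ [_ [a [b ->]] <-]; rewrite setTI; apply: sub_sigma_algebra.
by move/continuousP: cf; apply; exact: interval_open.
Qed.

Lemma continuous_compact_integrable_rV (R : realType) (n : nat)
    (nu : probability (borel_rV R n) R) (D : set 'rV[R]_n)
    (f : 'rV[R]_n -> R) :
  measurable (D : set (borel_rV R n)) -> compact D -> continuous f ->
  nu.-integrable D (EFin \o f).
Proof.
move=> mD cD cf; apply: measurable_bounded_integrable => //.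
- exact: le_lt_trans (probability_le1 _ _) (ltry _).
- by apply: measurable_funTS; exact: continuous_borel_measurable.
- have /compact_bounded[M [_ Mf]] :=
    continuous_compact (continuous_subspaceT cf) cD.
  exists M; split; rewrite ?num_real// => r Mr y Dy; apply: Mf Mr _ _.
  by exists y.
Qed.

Lemma continuous_sub (R : realType) (V : topologicalType) (f g : V -> R) :
  continuous f -> continuous g -> continuous (fun y => f y - g y).
Proof. by move=> cf cg y; exact: (cvgB (cf y) (cg y)). Qed.

Lemma continuous_norm (R : realType) (V : topologicalType) (f : V -> R) :
  continuous f -> continuous (fun y => `|f y|).
Proof. by move=> cf y; exact: (cvg_norm (cf y)). Qed.

Lemma continuous_mul (R : realType) (V : topologicalType) (f g : V -> R) :
  continuous f -> continuous g -> continuous (fun y => f y * g y).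
Proof. by move=> cf cg y; exact: (cvgM (cf y) (cg y)). Qed.

Lemma continuous_sum (R : realType) (V : topologicalType) (I : Type)
    (r : seq I) (f : I -> V -> R) :
  (forall i, continuous (f i)) -> continuous (fun y => \sum_(i <- r) f i y).
Proof.
by move=> cf; apply: (@continuous_big R I +%R) => //; exact: add_continuous.
Qed.

Lemma tpow_continuous (R : realType) (n d : nat)
    (i : {ffun 'I_d -> 'I_n}) :
  continuous (fun y : 'rV[R]_n => tpow d y i).
Proof.
under eq_fun do rewrite ffunE.
apply: (@continuous_big R 'I_d *%R) => [|k _]; last exact: coord_continuous.
exact: mul_continuous.
Qed.

Lemma enorm_continuous (R : realType) (n : nat) :
  continuous (@enorm R n).
Proof.
move=> y.
apply: (@continuous_comp _ _ _ (fun y : 'rV[R]_n => \sum_i y 0 i ^+ 2)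
  Num.sqrt).
  apply: continuous_sum => i {}y; under eq_fun do rewrite expr2.
  by apply: continuous_mul; exact: coord_continuous.
exact: sqrt_continuous.
Qed.

Lemma annulus_compact (R : realType) (n : nat) (Rm Rp : R) :
  compact (@annulus R n Rm Rp).
Proof.
apply: bounded_closed_compact; last first.
  have -> : @annulus R n Rm Rp = @enorm R n @^-1` `[Rm, Rp].
    by apply/seteqP; split=> y; rewrite /= in_itv.
  by apply: closed_comp => [y _|]; [exact: enorm_continuous|exact: itv_closed].
exists Rp; split; rewrite ?num_real// => r Rpr y /andP[_ yRp].
have /ltW r0 : 0 < r.
  by apply: le_lt_trans Rpr; exact: le_trans (sqrtr_ge0 _) yRp.
(* The norm on row vectors is the sup norm, which the Euclidean one dominates. *)
rewrite /Num.norm/= mx_normrE; apply/bigmax_leP; split => // -[i j] _ /=.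
apply: le_trans (ltW Rpr); apply: le_trans yRp.
rewrite -sqrtr_sqr ord1 ler_wsqrtr// (bigD1 j)//= lerDl.
by apply: sumr_ge0 => k _; exact: sqr_ge0.
Qed.

Lemma annulus_measurable (R : realType) (n : nat) (Rm Rp : R) :
  measurable (annulus Rm Rp : set (borel_rV R n)).
Proof.
have := continuous_borel_measurable (@enorm_continuous R n) measurableT
  (measurable_itv `[Rm, Rp]).
by rewrite setTI; congr measurable.
Qed.

Lemma annulus_integrable (R : realType) (n : nat) (Rm Rp : R)
    (nu : probability (borel_rV R n) R) (f : 'rV[R]_n -> R) :
  continuous f -> nu.-integrable (annulus Rm Rp) (EFin \o f).
Proof.
apply: continuous_compact_integrable_rV; first exact: annulus_measurable.
exact: annulus_compact.
Qed.

(** * Euclidean inner product and pure powers *)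

Definition edot (R : realType) (n : nat) (x y : 'rV[R]_n) : R :=
  \sum_(j < n) x 0 j * y 0 j.

Lemma edotxx (R : realType) (n : nat) (x : 'rV[R]_n) :
  edot x x = enorm x ^+ 2.
Proof.
rewrite /enorm sqr_sqrtr; last by apply: sumr_ge0 => i _; exact: sqr_ge0.
by apply: eq_bigr => i _; rewrite expr2.
Qed.

Lemma edotC (R : realType) (n : nat) (x y : 'rV[R]_n) : edot x y = edot y x.
Proof. by apply: eq_bigr => i _; rewrite mulrC. Qed.

Lemma edotBl (R : realType) (n : nat) (x y z : 'rV[R]_n) :
  edot (x - y) z = edot x z - edot y z.
Proof. by rewrite -sumrB; apply: eq_bigr => i _; rewrite !mxE mulrBl. Qed.

Lemma edotBr (R : realType) (n : nat) (x y z : 'rV[R]_n) :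
  edot x (y - z) = edot x y - edot x z.
Proof. by rewrite edotC edotBl !(edotC x). Qed.

Lemma edotZl (R : realType) (n : nat) (a : R) (x y : 'rV[R]_n) :
  edot (a *: x) y = a * edot x y.
Proof. by rewrite mulr_sumr; apply: eq_bigr => i _; rewrite !mxE mulrA. Qed.

Lemma enorm_ge0 (R : realType) (n : nat) (x : 'rV[R]_n) : 0 <= enorm x.
Proof. exact: sqrtr_ge0. Qed.

(** The nonnegative quantity behind Cauchy-Schwarz is the squared norm of the
    component of [y] orthogonal to [x], scaled by [|x|^2]. *)
Lemma normr_edot_le (R : realType) (n : nat) (x y : 'rV[R]_n) :
  `|edot x y| <= enorm x * enorm y.
Proof.
have [x0|x0] := eqVneq (enorm x) 0.
  have xx0 : \sum_j x 0 j * x 0 j = 0 by rewrite [LHS]edotxx x0 expr0n.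
  rewrite x0 mul0r normr_le0 /edot big1// => j _.
  have /eqP : x 0 j ^+ 2 = 0.
    by apply: psumr_eq0P xx0 _ _ => // k _; exact: sqr_ge0.
  by rewrite sqrf_eq0 => /eqP ->; rewrite mul0r.
rewrite -(@ler_pXn2r _ 2)// ?nnegrE ?mulr_ge0 ?enorm_ge0//.
rewrite real_normK ?num_real// exprMn -!edotxx.
have N0 : 0 < edot x x by rewrite edotxx exprn_gt0// lt0r x0 enorm_ge0.
have : 0 <= edot x x * (edot x x * edot y y - edot x y ^+ 2).
  have : 0 <= enorm (edot x x *: y - edot x y *: x) ^+ 2 by exact: sqr_ge0.
  rewrite -edotxx edotBl !edotBr !edotZl !(edotC _ (_ *: _)) !edotZl.
  rewrite (edotC y x).
  by congr (_ <= _); ring.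
by rewrite pmulr_rge0// subr_ge0.
Qed.

Lemma normr_edot_ler_sum (R : realType) (n : nat) (x y : 'rV[R]_n) :
  `|edot x y| <= \sum_j `|x 0 j| * `|y 0 j|.
Proof.
apply: le_trans (ler_norm_sum _ _ _) _.
by apply: ler_sum => j _; rewrite normrM.
Qed.

Lemma edot_continuous (R : realType) (n : nat) (x : 'rV[R]_n) :
  continuous (edot x).
Proof.
apply: continuous_sum => j; apply: continuous_mul; first exact: cst_continuous.
exact: coord_continuous.
Qed.

Lemma normr_edotB_continuous (R : realType) (n : nat) (x : 'rV[R]_n) (c : R) :
  continuous (fun y : 'rV[R]_n => `|edot x y - c|).
Proof.
apply: continuous_norm; apply: continuous_sub; last exact: cst_continuous.
exact: edot_continuous.
Qed.

Lemma tdot_tpow (R : realType) (n d : nat) (x y : 'rV[R]_n) :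
  tdot (tpow d x) (tpow d y) = edot x y ^+ d.
Proof. by rewrite tdot_puret prodr_const card_ord. Qed.

Lemma sum_tpowB (R : realType) (n d : nat) (x y z : 'rV[R]_n) :
  \sum_i (tpow d x i - tpow d y i) * (tpow d x i - tpow d z i)
    = edot x x ^+ d - edot x y ^+ d - edot x z ^+ d + edot y z ^+ d.
Proof.
rewrite -!tdot_tpow /tdot -!sumrB -big_split/=; apply: eq_bigr => i _.
by ring.
Qed.

(** * The scalar kernel estimate *)

Lemma ler_normB_expr (R : realFieldType) (d : nat) (M s t : R) :
  `|s| <= M -> `|t| <= M ->
  `|s ^+ d - t ^+ d| <= d%:R * M ^+ d.-1 * `|s - t|.
Proof.
move=> sM tM; rewrite subrXX normrM [leRHS]mulrC ler_wpM2l//.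
apply: le_trans (ler_norm_sum _ _ _) _.
rewrite -[d in d%:R]card_ord mulr_natl -sumr_const; apply: ler_sum => i _.
have -> : d.-1 = (d.-1 - i + i)%N.
  by rewrite subnK// -ltnS prednK// (leq_trans _ (ltn_ord i)).
rewrite addnK exprD normrM !normrX.
by apply: ler_pM; rewrite ?exprn_ge0// lerXn2r// nnegrE// (le_trans _ sM).
Qed.

(** Here [a = |x|], [s = <x,y>], [t = <x,z>], [w = <y,z>], and [H] bounds
    [|<x - y, x - z>|].  The comparison value [(s t / a^2)^d] for [w^d] is chosen
    so that what is left of the kernel factors, while its base stays below
    [M^2] in absolute value, like [w]. *)
Lemma power_kernel_le (R : realFieldType) (d : nat) (a M s t w H : R) :
  0 < a -> a <= M -> `|s| <= a * M -> `|t| <= a * M -> `|w| <= M ^+ 2 ->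
  `|a ^+ 2 - s - t + w| <= H ->
  (a ^+ 2) ^+ d - s ^+ d - t ^+ d + w ^+ d <=
    d%:R * (M ^+ 2) ^+ d.-1 * H
    + (d%:R + d%:R ^+ 2) * (M ^+ 2) ^+ d.-1 / a ^+ 2
      * (`|s - a ^+ 2| * `|t - a ^+ 2|).
Proof.
case: d => [|d]; first by move=> *; rewrite !expr0; lra.
move=> a0 aM sM tM wM HH.
have M0 : 0 < M by exact: lt_le_trans aM.
have N0 : 0 < a ^+ 2 by rewrite exprn_gt0.
have NM : `|a ^+ 2| <= a * M by rewrite (gtr0_norm N0) expr2 ler_pM2l.
set N := a ^+ 2 in N0 NM HH *.
have stM : `|s * t / N| <= M ^+ 2.
  rewrite !normrM normfV (gtr0_norm N0) ler_pdivrMr//.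
  apply: le_trans (ler_pM (normr_ge0 _) (normr_ge0 _) sM tM) _.
  by rewrite le_eqVlt; apply/orP; left; apply/eqP; rewrite /N; ring.
have EN : N = a ^+ 2 by [].
clearbody N.
have -> : N ^+ d.+1 - s ^+ d.+1 - t ^+ d.+1 + w ^+ d.+1 =
    (w ^+ d.+1 - (s * t / N) ^+ d.+1)
    + (s ^+ d.+1 - N ^+ d.+1) * (t ^+ d.+1 - N ^+ d.+1) / N ^+ d.+1.
  rewrite !exprMn exprVn.
  have : N ^+ d.+1 != 0 by rewrite expf_neq0// gt_eqF.
  by move: (N ^+ _) (s ^+ _) (t ^+ _) (w ^+ _) => A B C D A0; field.
set m := (d.+1)%:R.
have -> : m * (M ^+ 2) ^+ d * H
    + (m + m ^+ 2) * (M ^+ 2) ^+ d / N * (`|s - N| * `|t - N|) =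
    m * (M ^+ 2) ^+ d * (H + `|s - N| * `|t - N| / N)
    + (m * (a * M) ^+ d * `|s - N|) * (m * (a * M) ^+ d * `|t - N|) / N ^+ d.+1.
  have -> : (a * M) ^+ d = a ^+ d * M ^+ d by rewrite exprMn.
  have -> : N ^+ d.+1 = N * (a ^+ d * a ^+ d).
    by rewrite exprS -(exprMn d a a) EN.
  have -> : (M ^+ 2) ^+ d = M ^+ d * M ^+ d by rewrite -exprMn.
  have : N != 0 by rewrite gt_eqF.
  have : a ^+ d != 0 by rewrite expf_neq0// gt_eqF.
  by move: (a ^+ d) (M ^+ d) => A B A0 E0; field; rewrite A0.
apply: lerD.
  apply: le_trans (ler_norm _) _; apply: le_trans (ler_normB_expr _ wM stM) _.
  rewrite ler_wpM2l ?mulr_ge0 ?exprn_ge0 ?(ltW M0)//.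
  have -> : w - s * t / N = (N - s - t + w) - (s - N) * (t - N) / N.
    by field; rewrite gt_eqF.
  apply: le_trans (ler_normB _ _) _; apply: lerD => //.
  by rewrite !normrM normfV (gtr0_norm N0).
rewrite ler_wpM2r ?invr_ge0 ?exprn_ge0 ?(ltW N0)//.
apply: le_trans (ler_norm _) _; rewrite normrM.
by apply: ler_pM => //; exact: ler_normB_expr.
Qed.

(** * Integration over the annulus *)

Lemma sqr_tnorm_defect (R : realType) (n d : nat) (Rm Rp : R)
    (x : 'rV[R]_n) (nu : probability (borel_rV R n) R) :
  nu (annulus Rm Rp) = 1%E ->
  tdot (tpow d x - tintegral nu (tpow d)) (tpow d x - tintegral nu (tpow d))
    = \sum_i (\int[nu]_(y in annulus Rm Rp) (tpow d x i - tpow d y i)) ^+ 2.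
Proof.
move=> nu1; have mD := annulus_measurable (n := n) Rm Rp.
apply: eq_bigr => i _; rewrite -expr2 !ffunE; congr (_ ^+ 2).
rewrite RintegralB//; last 2 first.
- by apply: annulus_integrable; exact: cst_continuous.
- by apply: annulus_integrable; exact: tpow_continuous.
rewrite Rintegral_cst// [fine _](congr1 fine nu1) mulr1.
rewrite (Rintegral_full_measure mD nu1) ?ffunE//.
by apply: continuous_borel_measurable; exact: tpow_continuous.
Qed.

(** The kernel estimate integrated twice: the coordinate part becomes the
    squared norm of [qvec], the radial part the square of an integral. *)
Lemma sqr_tnorm_defect_le (R : realType) (n d : nat) (Rm Rp : R)
    (x : 'rV[R]_n) (nu : probability (borel_rV R n) R) :
  0 < Rm -> annulus Rm Rp x -> nu (annulus Rm Rp) = 1%E ->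
  tdot (tpow d x - tintegral nu (tpow d)) (tpow d x - tintegral nu (tpow d))
    <= d%:R * (Rp ^+ 2) ^+ d.-1 * enorm (qvec nu x) ^+ 2
       + (d%:R + d%:R ^+ 2) * (Rp ^+ 2) ^+ d.-1 / enorm x ^+ 2
         * (\int[nu]_(y in annulus Rm Rp) `|edot x y - edot x x|) ^+ 2.
Proof.
move=> Rm0 /[dup] Dx /andP[mx xp] nu1.
have x0 : 0 < enorm x by exact: lt_le_trans mx.
have mD := annulus_measurable (n := n) Rm Rp.
have coord_cont j : continuous (fun y : 'rV[R]_n => `|x 0 j - y 0 j|).
  apply: continuous_norm; apply: continuous_sub; first exact: cst_continuous.
  exact: coord_continuous.
have edot_cont := @normr_edotB_continuous R n x (edot x x).
rewrite (sqr_tnorm_defect _ _ nu1).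
(* The left summand indexes the coordinates, the right one the radial defect. *)
pose c (j : 'I_n + unit) := if j is inl _ then d%:R * (Rp ^+ 2) ^+ d.-1
  else (d%:R + d%:R ^+ 2) * (Rp ^+ 2) ^+ d.-1 / enorm x ^+ 2.
pose f (j : 'I_n + unit) (y : 'rV[R]_n) :=
  if j is inl j then `|x 0 j - y 0 j| else `|edot x y - edot x x|.
have unitE (F : unit -> R) : \sum_u F u = F tt.
  by rewrite (big_pred1 tt) => // -[].
apply: (@le_trans _ _ (\sum_j c j *
    (\int[nu]_(y in annulus Rm Rp) f j y) ^+ 2)); last first.
  rewrite big_sumType/= unitE lerD2r -mulr_sumr -edotxx.
  rewrite le_eqVlt; apply/orP; left; apply/eqP; congr (_ * _).
  apply: eq_bigr => j _; rewrite !mxE -expr2; congr (_ ^+ 2); apply/esym.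
  by apply: Rintegral_full_measure => //; exact: continuous_borel_measurable.
apply: sqnorm_Rintegral_le => //.
- move=> i; apply: annulus_integrable.
  apply: continuous_sub; first exact: cst_continuous.
  exact: tpow_continuous.
- by move=> [j|u]; apply: annulus_integrable; [exact: coord_cont|].
move=> y z Dy Dz; have /andP[_ yp] := Dy; have /andP[_ zp] := Dz.
rewrite big_sumType/= unitE -mulr_sumr sum_tpowB edotxx.
apply: power_kernel_le => //.
- by apply: le_trans (normr_edot_le _ _) _; rewrite ler_pM2l.
- by apply: le_trans (normr_edot_le _ _) _; rewrite ler_pM2l.
- apply: le_trans (normr_edot_le _ _) _; rewrite expr2.
  by apply: ler_pM; rewrite ?enorm_ge0.
have -> : enorm x ^+ 2 - edot x y - edot x z + edot y z = edot (x - y) (x - z).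
  by rewrite edotBl !edotBr -edotxx (edotC y x); ring.
apply: le_trans (normr_edot_ler_sum _ _) _.
by apply: ler_sum => j _; rewrite !mxE.
Qed.

(** The component of [y - x] along [x] is of second order up to the width of
    the annulus, because the norms of [x] and [y] almost agree. *)
Lemma normr_edotB_le (R : realType) (n : nat) (Rm Rp : R) (x y : 'rV[R]_n) :
  0 < Rm -> annulus Rm Rp x -> annulus Rm Rp y ->
  `|edot x y - edot x x| <= Rp * (Rp - Rm) + enorm (x - y) ^+ 2.
Proof.
move=> Rm0 /andP[mx xp] /andP[my yp].
have : edot (x - y) (x - y) = enorm x ^+ 2 - 2 * edot x y + enorm y ^+ 2.
  by rewrite edotBl !edotBr -!edotxx (edotC y x); ring.
rewrite !edotxx => E; rewrite ler_norml; apply/andP.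
have := sqr_ge0 (enorm (x - y)).
split; nra.
Qed.

Lemma Rintegral_normr_edotB_le (R : realType) (n : nat) (Rm Rp : R)
    (x : 'rV[R]_n) (nu : probability (borel_rV R n) R) :
  0 < Rm -> annulus Rm Rp x -> nu (annulus Rm Rp) = 1%E ->
  \int[nu]_(y in annulus Rm Rp) `|edot x y - edot x x|
    <= Rp * (Rp - Rm) + \int[nu]_y enorm (x - y) ^+ 2.
Proof.
move=> Rm0 Dx nu1; have mD := annulus_measurable (n := n) Rm Rp.
have edot_cont := @normr_edotB_continuous R n x (edot x x).
have dist_cont : continuous (fun y : 'rV[R]_n => enorm (x - y) ^+ 2).
  under eq_fun do rewrite -edotxx.
  apply: continuous_sum => j; under eq_fun do rewrite !mxE.
  by apply: continuous_mul; apply: continuous_sub;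
    try exact: cst_continuous; exact: coord_continuous.
rewrite (Rintegral_full_measure mD nu1); last first.
  exact: continuous_borel_measurable.
have -> : Rp * (Rp - Rm) = \int[nu]_(y in annulus Rm Rp) (Rp * (Rp - Rm)).
  by rewrite Rintegral_cst// [fine _](congr1 fine nu1) mulr1.
rewrite -RintegralD//; last 2 first.
- by apply: annulus_integrable; exact: cst_continuous.
- exact: annulus_integrable.
apply: le_Rintegral => //.
- exact: annulus_integrable.
- apply: annulus_integrable => y.
  exact: (cvgD (cvg_cst (Rp * (Rp - Rm))) (dist_cont y)).
- by move=> y Dy; exact: normr_edotB_le Dy.
Qed.

Theorem lemma4p3 (R : realType) :
  exists2 C : R, 0 < C &
  forall (n d : nat) (Rm Rp : R), (0 < n)%N -> (0 < d)%N ->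
    0 < Rm -> Rm <= Rp -> Rp <= 2 * Rm ->
  forall (x : 'rV[R]_n) (nu : probability (borel_rV R n) R),
    annulus Rm Rp x -> nu (annulus Rm Rp) = 1%E ->
    tnorm (tpow d x - tintegral nu (tpow d)) <=
      C * Num.sqrt d%:R * Rp ^+ d.-1 * enorm (qvec nu x)
      + C * d%:R * Rp ^ (d%:Z - 2)
        * (Rp * (Rp - Rm) + \int[nu]_y enorm (x - y) ^+ 2).
Proof.
exists 3 => // n d Rm Rp _ d0 Rm0 RmRp Rp2 x nu Dx nu1.
have /andP[mx _] := Dx.
have Rp0 : 0 < Rp by exact: lt_le_trans RmRp.
have x0 : 0 < enorm x by exact: lt_le_trans mx.
have S2 := sqr_tnorm_defect_le d Rm0 Dx nu1.
have UB := Rintegral_normr_edotB_le Rm0 Dx nu1.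
have U0 : 0 <= \int[nu]_(y in annulus Rm Rp) `|edot x y - edot x x|.
  by apply: Rintegral_ge0.
set B := Rp * (Rp - Rm) + _ in UB *.
set U := \int[nu]_(y in _) _ in S2 UB U0.
set q := enorm (qvec nu x) in S2 *.
set Q := Rp ^+ d.-1.
have -> : Rp ^ (d%:Z - 2) = Q / Rp.
  rewrite -[in LHS](prednK d0) -addn1 PoszD.
  rewrite (_ : _ - 2 = d.-1%:Z - 1); last by ring.
  by rewrite expfzDr ?gt_eqF// -exprnP exprN1.
have Q0 : 0 <= Q by rewrite exprn_ge0// ltW.
have q0 : 0 <= q by exact: enorm_ge0.
set X := Num.sqrt d%:R * Q * q.
set Y := d%:R * (Q / Rp) * B.
have X0 : 0 <= X by rewrite !mulr_ge0// sqrtr_ge0.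
have Y0 : 0 <= Y by rewrite !mulr_ge0 ?invr_ge0 ?(ltW Rp0)// (le_trans U0).
have QQ : (Rp ^+ 2) ^+ d.-1 = Q ^+ 2 by rewrite exprAC.
have X2 : X ^+ 2 = d%:R * (Rp ^+ 2) ^+ d.-1 * q ^+ 2.
  by rewrite !exprMn sqr_sqrtr// QQ.
(* Here [d <= d^2], and [1 / |x|^2 <= 4 / Rp^2] because [Rp <= 2 Rm]. *)
have Y2 : (d%:R + d%:R ^+ 2) * (Rp ^+ 2) ^+ d.-1 / enorm x ^+ 2 * U ^+ 2
    <= 8 * Y ^+ 2.
  have -> : 8 * Y ^+ 2 =
      (2 * d%:R ^+ 2) * (Rp ^+ 2) ^+ d.-1 * (4 / Rp ^+ 2) * B ^+ 2.
    by rewrite QQ /Y; field; rewrite gt_eqF.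
  have d1 : 1 <= d%:R :> R by rewrite ler1n.
  have dd0 : 0 <= (d%:R + d%:R ^+ 2) * (Rp ^+ 2) ^+ d.-1.
    by rewrite QQ; apply: mulr_ge0 (sqr_ge0 _); rewrite addr_ge0 ?sqr_ge0.
  apply: ler_pM; rewrite ?sqr_ge0//.
  - by rewrite mulr_ge0 ?invr_ge0 ?sqr_ge0.
  - apply: ler_pM => //.
    + by rewrite invr_ge0 sqr_ge0.
    + by rewrite ler_wpM2r ?exprn_ge0 ?sqr_ge0//; nra.
    + rewrite ler_pdivlMr ?exprn_gt0// mulrC ler_pdivrMr ?exprn_gt0//.
      by nra.
  - by rewrite lerXn2r ?nnegrE// (le_trans U0).
have -> : 3 * Num.sqrt d%:R * Q * q + 3 * d%:R * (Q / Rp) * B = 3 * X + 3 * Y.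
  by rewrite /X /Y; ring.
have XY0 : 0 <= 3 * X + 3 * Y by apply: addr_ge0; apply: mulr_ge0.
rewrite -[leRHS](ger0_norm XY0) -sqrtr_sqr.
by rewrite /tnorm ler_wsqrtr//; nra.
Qed.
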